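(* Suppose $y=G(x,y)$ is a well-conditioned 1-equation system with $G(x,y)=xA(y)$; that is, $A(y)=\sum_{n\ge 0}a_ny^n$ is a power series with nonnegative coefficients (and positive radius of convergence $\rho_A\in(0,\infty]$), and both $A(0)$ and $A''(y)$ are nonzero. Let $B(y)=yA'(y)-A(y)+A(0)$. Then the characteristic system of $y=G(x,y)$ is equivalent (for positive $x,y$) to $$B(y)=A(0),\qquad x=\frac{y}{A(y)},$$ and, writing $\mathcal{CP}$ for the set of characteristic points and $(\rho,\tau)$ for the extreme point of the system, one has: (a) $\mathcal{CP}=\emptyset$ if and only if $B(\rho_A)<A(0)$; (b) $B(\rho_A)\ge A(0)$ implies $\mathcal{CP}=\{(\rho,\tau)\}$; (c) $B(\rho_A)=A(0)$ implies $(\rho,\tau)$ is on the boundary of $\mathsf{Dom}^{+}(G)$; (d) $B(\rho_A)>A(0)$ implies $(\rho,\tau)$ is in the interior of $\mathsf{Dom}^{+}(G)$.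
   Context: A 1-equation system $y=G(x,y)$, with $G$ a power series in two variables, is well-conditioned if: (a) $G(x,y)$ has nonnegative real coefficients; (b) $G$ is holomorphic in a neighborhood of the origin; (c) $G(0,y)=0$; (d) $G(x,0)\neq 0$; (e) $\partial G/\partial y\ne 0$ (irreducibility); (f) $\partial^2G/\partial y^2\ne 0$. For such a system there is a unique formal power series $T(x)$ with nonnegative coefficients satisfying $T(x)=G(x,T(x))$ formally (it satisfies $T(0)=0$), called the standard solution. It is a standard fact that its radius of convergence $\rho$ lies in $(0,\infty)$ and that $\tau:=T(\rho)<\infty$; $(\rho,\tau)$ is the extreme point. A characteristic point is a point $(a,b)\in\mathbb{R}^2$ with $a,b>0$ solving the characteristic system $y=G(x,y)$, $1=\dfrac{\partial G}{\partial y}(x,y)$ (in particular both series converge at $(a,b)$). The positive domain is $\mathsf{Dom}^{+}(G)=\{(a,b):a,b>0,\ G(a,b)<\infty\}$. $B(y)=\sum_{n\ge 2}(n-1)a_ny^n$ is a power series with nonnegative coefficients; $B(\rho_A)\in[0,\infty]$ is its value at $\rho_A$ in the extended nonnegative reals ($\infty$ if the series diverges; in particular $B(\rho_A)=\infty$ when $\rho_A=\infty$). *)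

(* Defs.v *)
From Stdlib Require Import Reals Lra Lia.
From Coquelicot Require Import Coquelicot.
Open Scope R_scope.

(** Formal power series in one variable are sequences [nat -> R], as in
    Coquelicot; in two variables they are arrays [g : nat -> nat -> R], where
    [g i j] is the coefficient of [x^i y^j]. *)

(** Limit of the square partial sums.  When all the terms are nonnegative these
    partial sums increase, so this is the sum of the double series in [0, +oo],
    in whatever order it is summed; convergence means that it is finite. *)
Definition PSeries2 (g : nat -> nat -> R) (x y : R) : Rbar :=
  Lim_seq (fun N => sum_n (fun i => sum_n (fun j => g i j * x ^ i * y ^ j) N) N).

Definition PS2_derive_y (g : nat -> nat -> R) (i j : nat) : R :=
  INR (S j) * g i (S j).

(** A power series in two variables is holomorphic near the origin when it
    converges absolutely on a complex polydisc. *)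
Definition holomorphic_at_origin (g : nat -> nat -> R) : Prop :=
  exists r : R, 0 < r /\
    forall z w : C, Cmod z < r -> Cmod w < r ->
      Rbar_lt (PSeries2 (fun i j => Rabs (g i j)) (Cmod z) (Cmod w)) p_infty.

Record well_conditioned (g : nat -> nat -> R) : Prop := {
  wc_nonneg : forall i j, 0 <= g i j;
  wc_holomorphic : holomorphic_at_origin g;
  wc_at_x0 : forall j, g 0%nat j = 0;
  wc_at_y0 : exists i, g i 0%nat <> 0;
  wc_derive_y : exists i j, PS2_derive_y g i j <> 0;
  wc_derive_yy : exists i j, PS2_derive_y (PS2_derive_y g) i j <> 0
}.

Fixpoint PS_pow (t : nat -> R) (j : nat) : nat -> R :=
  match j with
  | O => fun n => match n with O => 1 | S _ => 0 end
  | S j' => PS_mult t (PS_pow t j')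
  end.

(** Coefficients of the formal substitution [G(x, T(x))], for [T(0) = 0]: the
    sum over [j] may stop at [n], since [x^(j+1)] divides [T(x)^(j+1)]. *)
Definition PS2_subst_y (g : nat -> nat -> R) (t : nat -> R) (n : nat) : R :=
  sum_n (fun i => sum_n (fun j => g i j * PS_pow t j (n - i)%nat) n) n.

(** [T(0) = 0] is what gives a meaning to the formal equation
    [T(x) = G(x, T(x))]. *)
Record standard_solution (g : nat -> nat -> R) (t : nat -> R) : Prop := {
  ss_nonneg : forall n, 0 <= t n;
  ss_at_0 : t 0%nat = 0;
  ss_eq : forall n, t n = PS2_subst_y g t n
}.

(** The extreme point.  [real] and [PSeries] return 0 on a radius or a sum
    equal to [+oo], so a pair with both coordinates positive is the genuine
    one. *)
Definition extreme_point (t : nat -> R) : R * R :=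
  let rho := real (CV_radius t) in (rho, PSeries t rho).

Definition characteristic_system (g : nat -> nat -> R) (x y : R) : Prop :=
  PSeries2 g x y = Finite y /\ PSeries2 (PS2_derive_y g) x y = Finite 1.

Definition characteristic_point (g : nat -> nat -> R) (p : R * R) : Prop :=
  0 < fst p /\ 0 < snd p /\ characteristic_system g (fst p) (snd p).

Definition pos_domain (g : nat -> nat -> R) (p : R * R) : Prop :=
  0 < fst p /\ 0 < snd p /\ Rbar_lt (PSeries2 g (fst p) (snd p)) p_infty.

Definition interior_R2 (D : R * R -> Prop) (p : R * R) : Prop := locally p D.

Definition boundary_R2 (D : R * R -> Prop) (p : R * R) : Prop :=
  ~ interior_R2 D p /\ ~ interior_R2 (fun q => ~ D q) p.

(** The two-variable series [x A(y)]. *)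
Definition x_times (a : nat -> R) (i j : nat) : R :=
  match i with 1%nat => a j | _ => 0 end.

Definition PS_const (c : R) (n : nat) : R :=
  match n with O => c | S _ => 0 end.

(** [y A'(y) - A(y) + A(0)] *)
Definition B_series (a : nat -> R) : nat -> R :=
  PS_plus (PS_minus (PS_incr_1 (PS_derive a)) a) (PS_const (a 0%nat)).

Lemma B_series_coef (a : nat -> R) (n : nat) :
  B_series a n = INR (n - 1) * a n.
Proof.
unfold B_series, PS_plus, PS_minus, PS_plus, PS_opp, PS_incr_1, PS_derive, PS_const.
destruct n as [|n].
- change (0 + - a 0%nat + a 0%nat = 0 * a 0%nat); ring.
- change (INR (S n) * a (S n) + - a (S n) + 0 = INR (S n - 1) * a (S n)).
  rewrite S_INR; replace (S n - 1)%nat with n by lia; ring.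
Qed.

(** Value in [0, +oo] of [B] at the radius of convergence of [A]; it is [+oo]
    at an infinite radius because [B] has a positive coefficient of positive
    degree as soon as [A] has nonnegative coefficients and [A'' <> 0]. *)
Definition B_at_radius (a : nat -> R) : Rbar :=
  match CV_radius a with
  | Finite r => Lim_seq (sum_n (fun n => B_series a n * r ^ n))
  | _ => p_infty
  end.

(* Main.v *)
Require Import Defs.
From Stdlib Require Import Reals Lra Lia Ranalysis5.
From Coquelicot Require Import Coquelicot.
Open Scope R_scope.

(** Let [v] be a root of [B(v) = A(0)].  Then [v A'(v) = A(v)], so the tangent of
    the convex function [A] at [v] is a line through the origin, and
    [y A(v) <= v A(y)] for all [y], strictly for [y <> v].  With
    [x0 = v / A(v)], induction on the partial sums of [T] gives [T(x0) <= v].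
    Conversely, wherever [T(x)] converges one has [x A(T(x)) <= T(x)], which
    together with the tangent inequality forces [x <= x0], and [T(x0) = v] when
    [x = x0].  Hence [(x0, v)] is the extreme point, and [v] is unique.  A root
    [v] exists exactly when [B] reaches [A(0)] on its interval of convergence,
    by the intermediate value theorem. *)

(** * Series with nonnegative terms *)

Lemma sum_n_le_loc (u v : nat -> R) (N : nat) :
  (forall n, (n <= N)%nat -> u n <= v n) -> sum_n u N <= sum_n v N.
Proof.
intros H; rewrite !sum_n_Reals; apply sum_Rle; auto.
Qed.

Lemma sum_n_zero (u : nat -> R) (N : nat) :
  (forall n, (n <= N)%nat -> u n = 0) -> sum_n u N = 0.
Proof.
intros H; rewrite sum_n_Reals; apply sum_eq_R0; auto.
Qed.

Lemma sum_n_nonneg (u : nat -> R) (N : nat) :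
  (forall n, 0 <= u n) -> 0 <= sum_n u N.
Proof.
intros H; rewrite sum_n_Reals; apply cond_pos_sum, H.
Qed.

Lemma sum_n_single (u : nat -> R) (k N : nat) :
  (k <= N)%nat -> (forall n, n <> k -> u n = 0) -> sum_n u N = u k.
Proof.
intros HkN Hu; induction N as [|N IH].
- rewrite sum_O; f_equal; lia.
- rewrite sum_Sn; change (sum_n u N + u (S N) = u k).
  destruct (Nat.eq_dec k (S N)) as [->|Hk].
  + rewrite sum_n_zero; [ring|]; intros n Hn; apply Hu; lia.
  + rewrite IH, (Hu (S N)) by lia; ring.
Qed.

Lemma sum_n_incr (u : nat -> R) (N M : nat) :
  (forall n, 0 <= u n) -> (N <= M)%nat -> sum_n u N <= sum_n u M.
Proof.
intros Hu HNM; induction HNM as [|M _ IH]; [lra|].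
rewrite sum_Sn; change plus with Rplus; specialize (Hu (S M)); lra.
Qed.

Lemma sum_n_le_is_series (u : nat -> R) (l : R) (N : nat) :
  (forall n, 0 <= u n) -> is_series u l -> sum_n u N <= l.
Proof.
intros Hu Hl; apply (is_lim_seq_incr_compare (sum_n u) l Hl).
intros n; apply sum_n_incr; auto.
Qed.

Lemma is_series_le_bound (u : nat -> R) (l M : R) :
  (forall N, sum_n u N <= M) -> is_series u l -> l <= M.
Proof.
intros HM Hl.
exact (is_lim_seq_le (sum_n u) (fun _ => M) l M HM Hl (is_lim_seq_const M)).
Qed.

Lemma is_series_le (u v : nat -> R) (l m : R) :
  (forall n, u n <= v n) -> is_series u l -> is_series v m -> l <= m.
Proof.
intros H Hu Hv.
refine (is_lim_seq_le (sum_n u) (sum_n v) l m _ Hu Hv).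
intros N; apply sum_n_le_loc; auto.
Qed.

(** The partial sums increase, so [Lim_seq] is a genuine limit, and [m_infty] is excluded because
    they stay nonnegative. *)
Lemma nonneg_series_cases (u : nat -> R) :
  (forall n, 0 <= u n) ->
  (exists l : R, is_series u l /\ Lim_seq (sum_n u) = Finite l) \/
  (~ ex_series u /\ Lim_seq (sum_n u) = p_infty /\
     forall M, exists N, M < sum_n u N).
Proof.
intros Hu.
assert (Hlim : is_lim_seq (sum_n u) (Lim_seq (sum_n u))).
{ apply Lim_seq_correct, ex_lim_seq_incr; intros n; apply sum_n_incr; auto. }
case_eq (Lim_seq (sum_n u)); [intros l| |]; intros El; rewrite El in Hlim.
- left; exists l; split; auto.
- right; split; [|split; auto].
  + intros [l Hl].
    pose proof (is_lim_seq_unique (sum_n u) l Hl); congruence.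
  + intros M; destruct (proj2 (is_lim_seq_spec _ _) Hlim M) as [N HN].
    exists N; apply HN; lia.
- exfalso.
  destruct (proj2 (is_lim_seq_spec _ _) Hlim 0) as [N HN].
  specialize (HN N (le_n _)); pose proof (sum_n_nonneg u N Hu); lra.
Qed.

Lemma nonneg_series_bounded (u : nat -> R) (M : R) :
  (forall n, 0 <= u n) -> (forall N, sum_n u N <= M) -> ex_series u.
Proof.
intros Hu HM; destruct (nonneg_series_cases u Hu) as [[l [Hl _]]|[_ [_ H]]].
- now exists l.
- destruct (H M) as [N HN]; specialize (HM N); lra.
Qed.

Lemma Lim_seq_nonneg_series (u : nat -> R) (l : R) :
  (forall n, 0 <= u n) -> (Lim_seq (sum_n u) = Finite l <-> is_series u l).
Proof.
intros Hu; split; intros H.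
- destruct (nonneg_series_cases u Hu) as [[l' [Hl El]]|[_ [E _]]].
  + replace l with l'; [auto|]; congruence.
  + congruence.
- now apply is_lim_seq_unique.
Qed.

Lemma is_series_pos (u : nat -> R) (l : R) (k : nat) :
  (forall n, 0 <= u n) -> 0 < u k -> is_series u l -> 0 < l.
Proof.
intros Hu Hk Hl; pose proof (sum_n_le_is_series u l k Hu Hl) as H.
destruct k as [|k].
- rewrite sum_O in H; lra.
- rewrite sum_Sn in H; change plus with Rplus in H.
  pose proof (sum_n_nonneg u k Hu); lra.
Qed.

(** * Power series with nonnegative coefficients and their radius of convergence *)

Lemma pterm_nonneg (a : nat -> R) (y : R) :
  (forall n, 0 <= a n) -> 0 <= y -> forall n, 0 <= a n * y ^ n.
Proof.
intros Ha Hy n; apply Rmult_le_pos; auto using pow_le.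
Qed.

Lemma pterm_le (a : nat -> R) (y z : R) :
  (forall n, 0 <= a n) -> 0 <= y <= z -> forall n, a n * y ^ n <= a n * z ^ n.
Proof.
intros Ha Hy n; apply Rmult_le_compat_l, pow_incr; auto.
Qed.

Lemma ex_series_le_CV_radius (a : nat -> R) (y : R) :
  0 <= y -> ex_series (fun n => a n * y ^ n) -> Rbar_le y (CV_radius a).
Proof.
intros Hy H; apply Rbar_not_lt_le; intros Hlt.
apply (CV_disk_outside a y).
- now rewrite Rabs_pos_eq.
- now apply ex_series_lim_0.
Qed.

Lemma lt_CV_radius_ex_series (a : nat -> R) (y : R) :
  0 <= y -> Rbar_lt y (CV_radius a) -> ex_series (fun n => a n * y ^ n).
Proof.
intros Hy H; apply ex_series_Rabs, CV_disk_inside; now rewrite Rabs_pos_eq.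
Qed.

Lemma Rbar_dense (x : R) (y : Rbar) :
  Rbar_lt x y -> exists z : R, x < z /\ Rbar_lt z y.
Proof.
destruct y as [y| |]; simpl; intros H.
- exists ((x + y) / 2); lra.
- exists (x + 1); lra.
- contradiction.
Qed.

(** * The double series of [x A(y)] and its well-conditionedness *)

Lemma PSeries2_x_times (b : nat -> R) (x y : R) :
  PSeries2 (x_times b) x y =
  Rbar_mult x (Lim_seq (sum_n (fun j => b j * y ^ j))).
Proof.
unfold PSeries2; rewrite <- Lim_seq_scal_l.
(* Only the row [i = 1] is nonzero, and the square partial sums contain it from [N = 1] on. *)
apply Lim_seq_ext_loc; exists 1%nat; intros N HN.
rewrite (sum_n_single _ 1%nat); [|auto|].
- rewrite <- (sum_n_mult_l (x : R_Ring)); apply sum_n_ext; intros j.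
  simpl; change mult with Rmult; ring.
- intros [|[|n]] Hn; try lia; apply sum_n_zero; intros; simpl; ring.
Qed.

Lemma PSeries2_x_times_eq (b : nat -> R) (x y l : R) :
  (forall n, 0 <= b n) -> 0 < x -> 0 <= y ->
  (PSeries2 (x_times b) x y = Finite l <->
   is_series (fun n => b n * y ^ n) (l / x)).
Proof.
intros Hb Hx Hy; rewrite PSeries2_x_times.
pose proof (pterm_nonneg b y Hb Hy) as Hp.
rewrite <- (Lim_seq_nonneg_series _ _ Hp).
destruct (nonneg_series_cases _ Hp) as [[m [_ ->]]|[_ [-> _]]].
- split; intros H; injection H; intros E.
  + assert (Em : m = l / x) by (rewrite <- E; field; lra); now rewrite Em.
  + assert (El : x * m = l) by (rewrite E; field; lra); now rewrite <- El.
- split; [|discriminate]; intros H.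
  rewrite Rbar_mult_comm, (is_Rbar_mult_unique _ _ _ (is_Rbar_mult_p_infty_pos x Hx)) in H.
  discriminate.
Qed.

Lemma PSeries2_x_times_lt_infty (b : nat -> R) (x y : R) :
  (forall n, 0 <= b n) -> 0 < x -> 0 <= y ->
  (Rbar_lt (PSeries2 (x_times b) x y) p_infty <->
   ex_series (fun n => b n * y ^ n)).
Proof.
intros Hb Hx Hy; rewrite PSeries2_x_times.
destruct (nonneg_series_cases _ (pterm_nonneg b y Hb Hy))
  as [[m [Hm ->]]|[Hn [-> _]]].
- simpl; split; [intros _; now exists m|auto].
- split; [|contradiction]; intros H; exfalso.
  rewrite Rbar_mult_comm, (is_Rbar_mult_unique _ _ _ (is_Rbar_mult_p_infty_pos x Hx)) in H.
  exact H.
Qed.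

Lemma PSeries2_ext (g h : nat -> nat -> R) (x y : R) :
  (forall i j, g i j = h i j) -> PSeries2 g x y = PSeries2 h x y.
Proof.
intros H; apply Lim_seq_ext; intros N; apply sum_n_ext; intros i.
apply sum_n_ext; intros j; now rewrite H.
Qed.

Lemma PS2_derive_y_x_times (a : nat -> R) (i j : nat) :
  PS2_derive_y (x_times a) i j = x_times (PS_derive a) i j.
Proof.
destruct i as [|[|i]]; unfold PS2_derive_y, PS_derive; cbn [x_times]; ring.
Qed.

Lemma PS_derive_nonneg (a : nat -> R) :
  (forall n, 0 <= a n) -> forall n, 0 <= PS_derive a n.
Proof.
intros Ha n; apply Rmult_le_pos; [apply pos_INR|apply Ha].
Qed.

Lemma well_conditioned_x_times (a : nat -> R) :
  well_conditioned (x_times a) <->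
  (forall n, 0 <= a n) /\ Rbar_lt (Finite 0) (CV_radius a) /\
  a 0%nat <> 0 /\ (exists n, PS_derive (PS_derive a) n <> 0).
Proof.
assert (HyyE : forall i j, PS2_derive_y (PS2_derive_y (x_times a)) i j =
                 x_times (PS_derive (PS_derive a)) i j).
{ intros i j; rewrite <- PS2_derive_y_x_times; unfold PS2_derive_y at 1 3.
  now rewrite PS2_derive_y_x_times. }
assert (HabsE : forall i j, Rabs (x_times a i j) = x_times (fun n => Rabs (a n)) i j).
{ intros [|[|i]] j; simpl; auto using Rabs_R0. }
split.
- intros [Hnn [r [Hr Hol]] _ [i Hi] _ [k [j Hyy]]].
  assert (Ha : forall n, 0 <= a n) by (intros n; apply (Hnn 1%nat n)).
  split; [auto|split; [|split]].
  (* Evaluating at the real point [z = w = r / 2] of the polydisc shows that [A] converges at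
     [r / 2 > 0]. *)
  + assert (Hm : Cmod (RtoC (r / 2)) = r / 2) by (rewrite Cmod_R; apply Rabs_pos_eq; lra).
    specialize (Hol (RtoC (r / 2)) (RtoC (r / 2))); rewrite Hm in Hol.
    specialize (Hol ltac:(lra) ltac:(lra)).
    rewrite (PSeries2_ext _ _ _ _ HabsE), PSeries2_x_times_lt_infty in Hol;
      [|intros; apply Rabs_pos|lra|lra].
    apply Rbar_lt_le_trans with (r / 2); [simpl; lra|].
    apply ex_series_le_CV_radius; [lra|].
    eapply ex_series_ext; [|exact Hol]; intros n; simpl; now rewrite Rabs_pos_eq.
  + now destruct i as [|[|i]].
  + exists j; rewrite HyyE in Hyy; now destruct k as [|[|k]].
- intros [Ha [Hr [Ha0 [n Hn]]]]; split.
  + intros [|[|i]] j; simpl; auto; lra.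
  + destruct (Rbar_dense 0 _ Hr) as [r [Hr0 Hrr]].
    exists r; split; [auto|]; intros z w Hz Hw.
    rewrite (PSeries2_ext _ _ _ _ HabsE).
    (* For [z <> 0], the double series is finite exactly when [A] converges at [Cmod w]; for [z = 0]
       it is [0], by the convention on products in [Rbar]. *)
    destruct (Rle_lt_or_eq_dec _ _ (Cmod_ge_0 z)) as [Hz0|Hz0].
    * apply PSeries2_x_times_lt_infty; auto using Cmod_ge_0, Rabs_pos.
      apply ex_series_ext with (fun n => a n * Cmod w ^ n).
      { intros k; now rewrite Rabs_pos_eq. }
      apply lt_CV_radius_ex_series; [apply Cmod_ge_0|].
      apply Rbar_lt_trans with r; auto.
    * rewrite PSeries2_x_times, <- Hz0, Rbar_mult_0_l; exact I.
  + now intros j.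
  + now exists 1%nat.
  + exists 1%nat, (S n); rewrite PS2_derive_y_x_times; simpl; intros E.
    apply Hn; unfold PS_derive at 1; rewrite E; ring.
  + exists 1%nat, n; now rewrite HyyE.
Qed.

(** * The series [B], the equation [B(y) = A(0)], and the tangent to [A] at a root *)

Lemma is_pseries_PS_const (c y : R) : is_pseries (PS_const c) y c.
Proof.
apply is_pseries_R.
refine (is_lim_seq_ext (fun _ => c) (sum_n _) c _ (is_lim_seq_const c)).
intros N; symmetry; rewrite (sum_n_single _ 0%nat); [simpl; ring|lia|].
intros [|n] Hn; [lia|simpl; ring].
Qed.

Lemma is_pseries_B (a : nat -> R) (y s d : R) :
  is_pseries a y s -> is_pseries (PS_derive a) y d ->
  is_pseries (B_series a) y (y * d - s + a 0%nat).
Proof.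
intros Hs Hd; apply (is_pseries_plus (V := R_NormedModule)); [|apply is_pseries_PS_const].
apply (is_pseries_minus (V := R_NormedModule)); [|auto].
now apply (is_pseries_incr_1 (V := R_NormedModule)).
Qed.

Lemma B_series_nonneg (a : nat -> R) :
  (forall n, 0 <= a n) -> forall n, 0 <= B_series a n.
Proof.
intros Ha n; rewrite B_series_coef; apply Rmult_le_pos; auto using pos_INR.
Qed.

(** From degree 2 on, the factor [n - 1] is at least 1, so the terms of [B] dominate those of
    [A]. *)
Lemma ex_series_of_B (a : nat -> R) (y : R) :
  (forall n, 0 <= a n) -> 0 <= y ->
  ex_series (fun n => B_series a n * y ^ n) -> ex_series (fun n => a n * y ^ n).
Proof.
intros Ha Hy H; apply (ex_series_incr_n _ 2).
apply (ex_series_incr_n _ 2) in H; destruct H as [l Hl].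
pose proof (pterm_nonneg a y Ha Hy) as Hp.
apply (nonneg_series_bounded _ l); [auto|]; intros N.
assert (Hle : forall k, a (2 + k)%nat * y ^ (2 + k) <=
                        B_series a (2 + k)%nat * y ^ (2 + k)).
{ intros k; rewrite B_series_coef, Rmult_assoc.
  rewrite <- (Rmult_1_l (a (2 + k)%nat * _)) at 1.
  apply Rmult_le_compat_r; [apply Hp|].
  apply (le_INR 1); lia. }
apply Rle_trans with (2 := sum_n_le_is_series _ l N
  (fun k => Rle_trans _ _ _ (Hp (2 + k)%nat) (Hle k)) Hl).
now apply sum_n_le_loc.
Qed.

(** The series [B + A - A(0)] is [y A'(y)]; its constant coefficient vanishes, so shifting it down
    by one degree divides it by [y]. *)
Lemma is_pseries_derive_of_B (a : nat -> R) (y s b : R) :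
  0 < y -> is_pseries a y s -> is_pseries (B_series a) y b ->
  is_pseries (PS_derive a) y ((b + s - a 0%nat) / y).
Proof.
intros Hy Hs Hb.
assert (Hinv : mult (/ y) y = one) by (apply Rinv_l; lra).
pose proof (is_pseries_plus (V := R_NormedModule) _ _ _ _ _ Hb Hs) as H1.
pose proof (is_pseries_minus (V := R_NormedModule) _ _ _ _ _ H1
  (is_pseries_PS_const (a 0%nat) y)) as H2.
pose proof (is_pseries_decr_1 (V := R_NormedModule) _ _ _ _ Hinv H2) as H3.
(* The long inner sum is the constant coefficient of [B + A - A(0)], left unsimplified by the shift;
   it equals [0]. *)
replace ((b + s - a 0%nat) / y) with
  (/ y * (b + s + - a 0%nat + - (0 + - a 0%nat + a 0%nat + a 0%nat + - a 0%nat)))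
  by (field; lra).
refine (is_pseries_ext _ _ _ _ _ H3); intros n.
change (PS_derive a n + - a (S n) + 0 + a (S n) + - 0 = PS_derive a n); ring.
Qed.

Lemma PSeries_pos (a : nat -> R) (y s : R) :
  (forall n, 0 <= a n) -> a 0%nat <> 0 -> 0 <= y -> is_pseries a y s -> 0 < s.
Proof.
intros Ha Ha0 Hy Hs; apply is_pseries_R in Hs.
apply (is_series_pos _ s 0%nat (pterm_nonneg a y Ha Hy)); [|auto].
simpl; specialize (Ha 0%nat); lra.
Qed.

(** The system reads [A(y) = y / x] and [A'(y) = 1 / x]. Eliminating [x] gives [y A'(y) = A(y)],
    that is [B(y) = A(0)]. Conversely, convergence of [B] at [y] yields that of [A] and then of
    [A']. *)
Lemma characteristic_system_x_times (a : nat -> R) (x y : R) :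
  (forall n, 0 <= a n) -> a 0%nat <> 0 -> 0 < x -> 0 < y ->
  (characteristic_system (x_times a) x y <->
   is_pseries (B_series a) y (a 0%nat) /\ x = y / PSeries a y).
Proof.
intros Ha Ha0 Hx Hy; unfold characteristic_system.
rewrite (PSeries2_ext _ _ x y (PS2_derive_y_x_times a)).
rewrite !PSeries2_x_times_eq, <- !is_pseries_R; auto using PS_derive_nonneg; try lra.
split.
- intros [HA HD]; split.
  + replace (a 0%nat) with (y * (1 / x) - y / x + a 0%nat) by (field; lra).
    now apply is_pseries_B.
  + rewrite (is_pseries_unique _ _ _ HA); field; lra.
- intros [HB Ex].
  assert (HA : is_pseries a y (PSeries a y)).
  { apply PSeries_correct, ex_pseries_R, ex_series_of_B; auto; [lra|].
    exists (a 0%nat); now apply is_pseries_R. }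
  pose proof (PSeries_pos a y _ Ha Ha0 (Rlt_le _ _ Hy) HA).
  split.
  + replace (y / x) with (PSeries a y); [auto|]; rewrite Ex; field; lra.
  + replace (1 / x) with ((a 0%nat + PSeries a y - a 0%nat) / y).
    * now apply is_pseries_derive_of_B.
    * rewrite Ex; field; lra.
Qed.

(* Convexity of [y => v * y ^ n - v ^ n * y], which vanishes at [v] with
   derivative [(n - 1) * v ^ n]; the bound is strict as soon as [2 <= n]. *)
Lemma pow_tangent (y v : R) (n : nat) :
  0 <= y -> 0 <= v ->
  v ^ n * (y + (INR n - 1) * (y - v)) <= v * y ^ n.
Proof.
intros Hy Hv; induction n as [|n IH]; [simpl; lra|].
apply Rmult_le_compat_l with (r := y) in IH; [|auto].
rewrite S_INR; simpl.
(* After multiplying the induction hypothesis by [y], its left side exceeds the required one by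
   exactly [v ^ n * n * (y - v) ^ 2]. *)
pose proof (Rmult_le_pos _ _ (pow_le v n Hv)
  (Rmult_le_pos _ _ (pos_INR n) (pow2_ge_0 (y - v)))).
nra.
Qed.

Lemma pow_tangent_strict (y v : R) (n : nat) :
  0 <= y -> 0 < v -> y <> v ->
  v ^ S (S n) * (y + (INR (S (S n)) - 1) * (y - v)) < v * y ^ S (S n).
Proof.
intros Hy Hv Hne.
pose proof (pow_tangent y v (S n) Hy (Rlt_le _ _ Hv)) as IH.
apply Rmult_le_compat_l with (r := y) in IH; [|auto].
rewrite (S_INR (S n)).
assert (0 < v ^ S n * (INR (S n) * (y - v) ^ 2)).
{ apply Rmult_lt_0_compat; [now apply pow_lt|].
  apply Rmult_lt_0_compat; [apply lt_0_INR; lia|].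
  apply pow2_gt_0; lra. }
change (v ^ S (S n)) with (v * v ^ S n); change (y ^ S (S n)) with (y * y ^ S n).
nra.
Qed.

(* Since [B v = a 0], the tangent of [A] at [v] passes through the origin. *)
Lemma tangent_at_characteristic (a : nat -> R) (v y s s' : R) :
  (forall n, 0 <= a n) -> 0 < v -> 0 <= y ->
  is_pseries (B_series a) v (a 0%nat) -> is_pseries a v s -> is_pseries a y s' ->
  y * s <= v * s' /\
  ((exists n, 0 < a (S (S n))) -> y <> v -> y * s < v * s').
Proof.
intros Ha Hv Hy HB Hs Hs'.
apply is_pseries_R in HB, Hs, Hs'.
pose proof (is_pseries_PS_const (a 0%nat) v) as HC; apply is_pseries_R in HC.
(* Termwise tangent gap. Its sum is [v * s' - y * s] minus [(y - v)] times the sum of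
   [(n - 1) a_n v^n], and the latter is [B(v) - A(0) = 0]. *)
set (gap n := a n * (v * y ^ n - v ^ n * (y + (INR n - 1) * (y - v)))).
assert (Hgap : is_series gap (v * s' - y * s)).
{ replace (v * s' - y * s) with
    (v * s' + - (y * s) + - ((y - v) * (a 0%nat + - a 0%nat))) by ring.
  refine (is_series_ext _ _ _ _
    (is_series_minus _ _ _ _
      (is_series_minus _ _ _ _
        (is_series_scal_l v _ _ Hs') (is_series_scal_l y _ _ Hs))
      (is_series_scal_l (y - v) _ _ (is_series_minus _ _ _ _ HB HC)))).
  intros n; unfold gap.
  change (v * (a n * y ^ n) + - (y * (a n * v ^ n)) +
    - ((y - v) * (B_series a n * v ^ n + - (PS_const (a 0%nat) n * v ^ n))) =
    a n * (v * y ^ n - v ^ n * (y + (INR n - 1) * (y - v)))).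
  (* At [n = 0] the natural subtraction [n - 1] truncates to [0] instead of [-1]; the [PS_const]
     term makes up the difference. *)
  rewrite B_series_coef; destruct n as [|n]; [simpl; ring|].
  rewrite S_INR; replace (S n - 1)%nat with n by lia; simpl PS_const; ring. }
assert (Hnn : forall n, 0 <= gap n).
{ intros n; apply Rmult_le_pos; [auto|].
  pose proof (pow_tangent y v n Hy (Rlt_le _ _ Hv)); lra. }
split.
- pose proof (sum_n_le_is_series gap _ 0 Hnn Hgap); rewrite sum_O in *.
  specialize (Hnn 0%nat); lra.
- intros [n Hn] Hne.
  enough (0 < v * s' - y * s) by lra.
  apply (is_series_pos gap _ (S (S n)) Hnn); [|auto].
  apply Rmult_lt_0_compat; [auto|].
  pose proof (pow_tangent_strict y v n Hy Hv Hne); lra.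
Qed.

(** * Powers of a formal power series and their values *)

Lemma sum_n_shift (u : nat -> R) (N : nat) :
  sum_n u (S N) = u 0%nat + sum_n (fun n => u (S n)) N.
Proof.
rewrite !sum_n_Reals, decomp_sum; [reflexivity|lia].
Qed.

Lemma PS_mult_term (a b : nat -> R) (x : R) (n : nat) :
  PS_mult a b n * x ^ n =
  sum_f_R0 (fun k => a k * x ^ k * (b (n - k)%nat * x ^ (n - k))) n.
Proof.
unfold PS_mult; rewrite Rmult_comm, scal_sum; apply sum_eq; intros k Hk.
replace n with (k + (n - k))%nat at 2 by lia; rewrite pow_add; ring.
Qed.

(** The product of the two partial sums contains all products of total degree at most [N], and what
    remains is nonnegative. *)
Lemma PS_mult_partial_sum_le (a b : nat -> R) (x : R) (N : nat) :
  (forall n, 0 <= a n) -> (forall n, 0 <= b n) -> 0 <= x ->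
  sum_n (fun n => PS_mult a b n * x ^ n) N <=
  sum_n (fun n => a n * x ^ n) N * sum_n (fun n => b n * x ^ n) N.
Proof.
intros Ha Hb Hx; rewrite (sum_n_ext _ _ _ (PS_mult_term a b x)).
destruct N as [|N]; [rewrite !sum_O; simpl; lra|].
rewrite !sum_n_Reals, cauchy_finite by lia.
rewrite <- (Rplus_0_r (sum_f_R0 _ (S N))) at 1; apply Rplus_le_compat_l.
apply cond_pos_sum; intros k; apply cond_pos_sum; intros l.
apply Rmult_le_pos; now apply pterm_nonneg.
Qed.

Lemma PS_pow_nonneg (t : nat -> R) (j : nat) :
  (forall n, 0 <= t n) -> forall n, 0 <= PS_pow t j n.
Proof.
intros Ht; induction j as [|j IH]; intros n.
- destruct n; simpl; lra.
- apply cond_pos_sum; intros k; apply Rmult_le_pos; auto.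
Qed.

Lemma PS_pow_small (t : nat -> R) (j n : nat) :
  t 0%nat = 0 -> (n < j)%nat -> PS_pow t j n = 0.
Proof.
intros Ht; revert n; induction j as [|j IH]; intros n Hn; [lia|].
apply sum_eq_R0; intros [|k] Hk; [rewrite Ht; ring|].
rewrite IH by lia; ring.
Qed.

Lemma PS_pow_partial_sum_le (t : nat -> R) (x : R) (j N : nat) :
  (forall n, 0 <= t n) -> 0 <= x ->
  sum_n (fun n => PS_pow t j n * x ^ n) N <= sum_n (fun n => t n * x ^ n) N ^ j.
Proof.
intros Ht Hx; induction j as [|j IH].
- rewrite (sum_n_single _ 0%nat); [simpl; lra|lia|].
  intros [|n] Hn; [lia|simpl; ring].
- eapply Rle_trans; [apply PS_mult_partial_sum_le; auto using PS_pow_nonneg|].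
  apply Rmult_le_compat_l; [apply sum_n_nonneg, pterm_nonneg; auto|auto].
Qed.

Lemma is_series_PS_pow (t : nat -> R) (x T : R) (j : nat) :
  (forall n, 0 <= t n) -> 0 <= x -> is_series (fun n => t n * x ^ n) T ->
  is_series (fun n => PS_pow t j n * x ^ n) (T ^ j).
Proof.
intros Ht Hx HT.
assert (Habs : forall u l, (forall n, 0 <= u n) -> is_series (fun n => u n * x ^ n) l ->
                 ex_series (fun n => Rabs (u n * x ^ n))).
{ intros u l Hu Hl; exists l; eapply is_series_ext; [|exact Hl].
  intros n; symmetry; apply Rabs_pos_eq, pterm_nonneg; auto. }
induction j as [|j IH].
- refine (is_series_ext _ _ _ _ (proj1 (is_pseries_R _ _ _) (is_pseries_PS_const 1 x))).
  now intros [|n].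
- refine (is_series_ext _ _ _ _ (is_series_mult _ _ _ _ HT IH (Habs _ _ Ht HT)
    (Habs _ _ (PS_pow_nonneg t j Ht) IH))).
  intros n; symmetry; apply PS_mult_term.
Qed.

Lemma PS2_subst_y_x_times (a t : nat -> R) (n : nat) :
  PS2_subst_y (x_times a) t (S n) = sum_n (fun j => a j * PS_pow t j n) (S n).
Proof.
unfold PS2_subst_y; rewrite (sum_n_single _ 1%nat); [|lia|].
- apply sum_n_ext; intros j; simpl; now rewrite Nat.sub_0_r.
- intros [|[|i]] Hi; try lia; apply sum_n_zero; intros; simpl; ring.
Qed.

(** * The standard solution and the extreme point *)

Section StandardSolution.

Variables (a t : nat -> R).
Hypothesis a_nonneg : forall n, 0 <= a n.
Hypothesis t_sol : standard_solution (x_times a) t.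

Let t_nonneg := ss_nonneg _ _ t_sol.

Lemma term_nonneg (j n : nat) : 0 <= a j * PS_pow t j n.
Proof.
apply Rmult_le_pos; auto using PS_pow_nonneg.
Qed.

Lemma standard_solution_coef_le (n M : nat) :
  (n <= M)%nat -> t (S n) <= sum_n (fun j => a j * PS_pow t j n) (S M).
Proof.
intros HM; rewrite (ss_eq _ _ t_sol), PS2_subst_y_x_times.
apply sum_n_incr; [intros j; apply term_nonneg|lia].
Qed.

(** Since [x^j] divides [T(x)^j], terms with [j > n] vanish: a longer sum changes nothing and a
    shorter one only drops nonnegative terms. *)
Lemma standard_solution_coef_ge (n M : nat) :
  sum_n (fun j => a j * PS_pow t j n) M <= t (S n).
Proof.
rewrite (ss_eq _ _ t_sol), PS2_subst_y_x_times.
destruct (Nat.le_gt_cases M (S n)) as [HM|HM].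
{ apply sum_n_incr; [intros j; apply term_nonneg|auto]. }
apply Req_le; induction HM as [|M HM IH].
- rewrite sum_Sn, PS_pow_small by (apply (ss_at_0 _ _ t_sol) || lia).
  change (sum_n (fun j => a j * PS_pow t j n) (S n) + a (S (S n)) * 0 =
          sum_n (fun j => a j * PS_pow t j n) (S n)); ring.
- rewrite sum_Sn, PS_pow_small by (apply (ss_at_0 _ _ t_sol) || lia).
  rewrite IH; change plus with Rplus.
  change (sum_n (fun j => a j * PS_pow t j n) (S n) + a (S M) * 0 =
          sum_n (fun j => a j * PS_pow t j n) (S n)); ring.
Qed.

(** Induction on [N]: with [T_N] the partial sum at [x], the coefficients give
    [T_(N+1) <= x A(T_N) <= x A(v) <= v]. *)
Lemma standard_solution_partial_sum_le (x v s : R) (N : nat) :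
  0 <= x -> 0 <= v -> is_pseries a v s -> x * s <= v ->
  sum_n (fun n => t n * x ^ n) N <= v.
Proof.
intros Hx Hv Hs Hxs; apply is_pseries_R in Hs.
induction N as [|N IH].
{ rewrite sum_O, (ss_at_0 _ _ t_sol); lra. }
rewrite sum_n_shift, (ss_at_0 _ _ t_sol), Rmult_0_l, Rplus_0_l.
apply Rle_trans with (2 := Hxs).
apply Rle_trans with
  (x * sum_n (fun j => a j * sum_n (fun n => PS_pow t j n * x ^ n) N) (S N)).
- rewrite (sum_n_ext (fun j => a j * _)
    (fun j => sum_n (fun n => a j * (PS_pow t j n * x ^ n)) N))
    by (intros j; symmetry; apply (sum_n_mult_l (a j : R_Ring))).
  rewrite sum_n_switch, <- (sum_n_mult_l (x : R_Ring)).
  apply sum_n_le_loc; intros n Hn.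
  rewrite (sum_n_ext (fun j => a j * _) (fun j => a j * PS_pow t j n * x ^ n))
    by (intros j; symmetry; apply Rmult_assoc).
  rewrite (sum_n_mult_r (x ^ n : R_Ring)).
  pose proof (Rmult_le_compat_r (x * x ^ n) _ _
    (Rmult_le_pos _ _ Hx (pow_le x n Hx)) (standard_solution_coef_le n N Hn)).
  change (t (S n) * (x * x ^ n) <=
    x * (sum_n (fun j => a j * PS_pow t j n) (S N) * x ^ n)); lra.
- apply Rmult_le_compat_l; [auto|].
  apply Rle_trans with (sum_n (fun j => a j * v ^ j) (S N)).
  + apply sum_n_le_loc; intros j _; apply Rmult_le_compat_l; [auto|].
    eapply Rle_trans; [now apply PS_pow_partial_sum_le|].
    apply pow_incr; split; [apply sum_n_nonneg, pterm_nonneg; auto|auto].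
  + apply sum_n_le_is_series; [apply pterm_nonneg; auto|auto].
Qed.

(** With [A] cut at degree [M], the left side is a finite combination of convergent series in [n],
    which can be compared with [T] coefficient by coefficient without exchanging two infinite
    sums. *)
Lemma standard_solution_sum_ge (x T : R) (M : nat) :
  0 <= x -> is_series (fun n => t n * x ^ n) T ->
  x * sum_n (fun j => a j * T ^ j) M <= T.
Proof.
intros Hx HT.
assert (HM : is_series (fun n => x * sum_n (fun j => a j * (PS_pow t j n * x ^ n)) M)
               (x * sum_n (fun j => a j * T ^ j) M)).
{ apply (is_series_scal_l (V := R_NormedModule) x).
  assert (Hj : forall j, is_series (fun n => a j * (PS_pow t j n * x ^ n)) (a j * T ^ j)).
  { intros j; apply (is_series_scal_l (V := R_NormedModule) (a j)).
    now apply is_series_PS_pow. }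
  induction M as [|M IH].
  - rewrite sum_O; refine (is_series_ext _ _ _ _ (Hj 0%nat)).
    intros n; now rewrite sum_O.
  - rewrite sum_Sn; refine (is_series_ext _ _ _ _ (is_series_plus _ _ _ _ IH (Hj (S M)))).
    intros n; now rewrite sum_Sn. }
apply is_series_le with (2 := HM) (v := fun n => t (S n) * x ^ S n).
- intros n.
  rewrite (sum_n_ext _ (fun j => a j * PS_pow t j n * x ^ n)) by (intros j; symmetry; apply Rmult_assoc).
  rewrite (sum_n_mult_r (x ^ n : R_Ring)).
  pose proof (Rmult_le_compat_r (x * x ^ n) _ _
    (Rmult_le_pos _ _ Hx (pow_le x n Hx)) (standard_solution_coef_ge n M)).
  change (x * (sum_n (fun j => a j * PS_pow t j n) M * x ^ n) <=
    t (S n) * (x * x ^ n)); lra.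
- apply (is_series_incr_1 (fun n => t n * x ^ n)).
  rewrite (ss_at_0 _ _ t_sol); simpl.
  change (is_series (fun n => t n * x ^ n) (T + 0 * 1)).
  now replace (T + 0 * 1) with T by ring.
Qed.

Hypothesis a0_neq0 : a 0%nat <> 0.
Hypothesis a_nonlinear : exists n, 0 < a (S (S n)).

Lemma extreme_point_eq (v : R) :
  0 < v -> is_pseries (B_series a) v (a 0%nat) ->
  extreme_point t = (v / PSeries a v, v).
Proof.
intros Hv HB.
set (s := PSeries a v); set (x0 := v / s).
assert (Hs : is_pseries a v s).
{ apply PSeries_correct, ex_pseries_R, ex_series_of_B; auto; [lra|].
  exists (a 0%nat); now apply is_pseries_R. }
assert (Hs0 : 0 < s) by (apply (PSeries_pos a v); auto; lra).
assert (Hx0 : 0 < x0) by now apply Rdiv_lt_0_compat.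
(* Letting the cut-off [M] grow: the partial sums of [A] at [T] are bounded by [T / x], so [A]
   converges there and [x A(T) <= T]. *)
assert (Hbound : forall x T, 0 < x -> is_series (fun n => t n * x ^ n) T ->
          0 <= T /\ exists s', is_pseries a T s' /\ 0 < s' /\ x * s' <= T).
{ intros x T Hx HT.
  assert (HT0 : 0 <= T).
  { apply Rle_trans with (sum_n (fun n => t n * x ^ n) 0).
    - apply sum_n_nonneg, pterm_nonneg; auto; lra.
    - apply sum_n_le_is_series; [apply pterm_nonneg; auto; lra|auto]. }
  split; [auto|].
  assert (Hle : forall N, sum_n (fun j => a j * T ^ j) N <= T / x).
  { intros N; apply Rle_div_r; [auto|]; rewrite Rmult_comm.
    apply standard_solution_sum_ge; auto; lra. }
  destruct (nonneg_series_bounded _ _ (pterm_nonneg a T a_nonneg HT0) Hle) as [s' Hs'].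
  exists s'; split; [now apply is_pseries_R|split].
  - apply (PSeries_pos a T); auto; now apply is_pseries_R.
  - rewrite Rmult_comm; apply Rle_div_r; [auto|].
    now apply (is_series_le_bound _ _ _ Hle). }
(* The tangent inequality gives [x * s' * s <= T * s <= v * s']; cancelling [s' > 0] leaves
   [x * s <= v]. *)
assert (Hx_le : forall x, 0 < x -> ex_series (fun n => t n * x ^ n) -> x <= x0).
{ intros x Hx [T HT]; destruct (Hbound x T Hx HT) as [HT0 [s' [Hs' [Hs'0 Hle]]]].
  destruct (tangent_at_characteristic a v T s s' a_nonneg Hv HT0 HB Hs Hs') as [Htan _].
  assert (HTpos : 0 < T) by (pose proof (Rmult_lt_0_compat _ _ Hx Hs'0); lra).
  apply Rle_div_r; [auto|].
  apply Rmult_le_reg_r with s'; [auto|].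
  apply Rmult_le_compat_r with (r := s) in Hle; lra. }
assert (Hpart : forall N, sum_n (fun n => t n * x0 ^ n) N <= v).
{ intros N; apply standard_solution_partial_sum_le with s; auto; try lra.
  right; unfold x0; field; lra. }
assert (Hex : ex_series (fun n => t n * x0 ^ n)).
{ apply nonneg_series_bounded with v; [apply pterm_nonneg; auto; lra|auto]. }
(* [T] converges at [x0] by the bound [v], and at no larger point. *)
assert (Hrad : CV_radius t = x0).
{ apply Rbar_le_antisym.
  - apply Rbar_not_lt_le; intros Hlt; apply Rbar_dense in Hlt.
    destruct Hlt as [x [Hx Hlt]].
    apply lt_CV_radius_ex_series in Hlt; [|lra].
    specialize (Hx_le x ltac:(lra) Hlt); lra.
  - apply ex_series_le_CV_radius; [lra|auto]. }
unfold extreme_point; rewrite Hrad; simpl real; f_equal.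
destruct Hex as [T HT].
rewrite (is_pseries_unique t x0 T) by now apply is_pseries_R.
destruct (Hbound x0 T Hx0 HT) as [HT0 [s' [Hs' [Hs'0 Hle]]]].
(* If [T <> v], the strict tangent inequality yields [v * s' = x0 * s' * s <= T * s < v * s']. *)
destruct (Req_dec T v) as [|Hne]; [auto|exfalso].
destruct (tangent_at_characteristic a v T s s' a_nonneg Hv HT0 HB Hs Hs') as [_ Htan].
specialize (Htan a_nonlinear Hne).
apply Rmult_le_compat_r with (r := s) in Hle; [|lra].
replace (x0 * s' * s) with (v * s') in Hle by (unfold x0; field; lra); lra.
Qed.

End StandardSolution.

(** * Existence and location of the roots of [B(v) = A(0)] *)

Lemma continuous_partial_sum (b : nat -> R) (N : nat) (y : R) :
  continuous (fun y => sum_n (fun n => b n * y ^ n) N) y.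
Proof.
induction N as [|N IH].
- apply continuous_ext with (fun _ => b 0%nat); [|apply continuous_const].
  intros z; rewrite sum_O; simpl; ring.
- apply continuous_ext with
    (fun y => plus (sum_n (fun n => b n * y ^ n) N) (b (S N) * y ^ S N)).
  { intros z; now rewrite sum_Sn. }
  apply (continuous_plus (V := R_NormedModule)); [exact IH|].
  apply continuity_pt_filterlim; reg.
Qed.

Section CharacteristicEquation.

Variable a : nat -> R.
Hypothesis a_nonneg : forall n, 0 <= a n.
Hypothesis a0_neq0 : a 0%nat <> 0.

Lemma B_pterm_nonneg (y : R) :
  0 <= y -> forall n, 0 <= B_series a n * y ^ n.
Proof.
intros Hy; apply pterm_nonneg; auto using B_series_nonneg.
Qed.

Lemma B_root_le_radius (v : R) :
  0 < v -> is_pseries (B_series a) v (a 0%nat) -> Rbar_le v (CV_radius a).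
Proof.
intros Hv HB; apply ex_series_le_CV_radius; [lra|].
apply ex_series_of_B; auto; [lra|exists (a 0%nat); now apply is_pseries_R].
Qed.

Lemma B_at_radius_ge (v : R) :
  0 < v -> is_pseries (B_series a) v (a 0%nat) ->
  Rbar_le (a 0%nat) (B_at_radius a).
Proof.
intros Hv HB; pose proof (B_root_le_radius v Hv HB) as Hle.
apply is_pseries_R in HB; unfold B_at_radius.
destruct (CV_radius a) as [r| |]; simpl in Hle; try exact I.
destruct (nonneg_series_cases _ (B_pterm_nonneg r ltac:(lra)))
  as [[l [Hl ->]]|[_ [-> _]]]; [|exact I].
apply (is_series_le _ _ _ _ (pterm_le _ v r (B_series_nonneg a a_nonneg) ltac:(lra)) HB Hl).
Qed.

(** A root at the radius itself would make [B_at_radius a] equal to [a 0]. *)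
Lemma B_root_lt_radius (v : R) :
  0 < v -> is_pseries (B_series a) v (a 0%nat) ->
  Rbar_lt (a 0%nat) (B_at_radius a) -> Rbar_lt v (CV_radius a).
Proof.
intros Hv HB; pose proof (B_root_le_radius v Hv HB) as Hle.
apply is_pseries_R in HB; unfold B_at_radius.
destruct (CV_radius a) as [r| |]; simpl in Hle; try contradiction; [|intros; exact I].
destruct Hle as [Hlt| ->]; [intros _; exact Hlt|].
rewrite (proj2 (Lim_seq_nonneg_series _ _ (B_pterm_nonneg r ltac:(lra))) HB).
simpl; lra.
Qed.

Lemma ex_series_B (y : R) :
  0 <= y -> Rbar_lt y (CV_radius a) -> ex_series (fun n => B_series a n * y ^ n).
Proof.
intros Hy Hlt; pose proof Hlt as Hlt'; rewrite <- CV_radius_derive in Hlt'.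
apply lt_CV_radius_ex_series in Hlt; [|auto].
apply lt_CV_radius_ex_series in Hlt'; [|auto].
destruct Hlt as [s Hs]; destruct Hlt' as [d Hd].
apply is_pseries_R in Hs, Hd.
exists (y * d - s + a 0%nat); now apply is_pseries_R, is_pseries_B.
Qed.

(** Intermediate value theorem on [[0, y]]: [B(0) = 0 < A(0)], while [B(y)] is at least its partial
    sum. *)
Lemma B_root_of_partial_sum_gt (y : R) (N : nat) :
  0 < y -> Rbar_lt y (CV_radius a) ->
  a 0%nat < sum_n (fun n => B_series a n * y ^ n) N ->
  exists v, 0 < v /\ is_pseries (B_series a) v (a 0%nat).
Proof.
intros Hy Hlt HN.
assert (HBy : a 0%nat < PSeries (B_series a) y).
{ apply Rlt_le_trans with (1 := HN).
  apply sum_n_le_is_series; [apply B_pterm_nonneg; lra|].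
  apply Series_correct, ex_series_B; auto; lra. }
(* [B] converges at a point [z] strictly between [y] and the radius of [A], which makes it
   continuous on all of [[0, y]]. *)
assert (Hrad : Rbar_lt y (CV_radius (B_series a))).
{ destruct (Rbar_dense _ _ Hlt) as [z [Hyz Hz]].
  apply Rbar_lt_le_trans with z; [exact Hyz|].
  apply ex_series_le_CV_radius; [lra|]; apply ex_series_B; auto; lra. }
destruct (IVT_interv (fun z => PSeries (B_series a) z - a 0%nat) 0 y)
  as [v [Hv Ev]].
- intros z Hz; apply continuity_pt_minus; [|apply continuity_pt_const; intros ? ?; auto].
  apply PSeries_continuity; rewrite Rabs_pos_eq by lra.
  apply Rbar_le_lt_trans with y; [apply Hz|auto].
- auto.
- rewrite PSeries_0, B_series_coef; simpl; pose proof (a_nonneg 0%nat); lra.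
- lra.
- exists v; split.
  + destruct (Rle_lt_or_eq_dec 0 v ltac:(lra)) as [|E]; [auto|exfalso].
    rewrite <- E, PSeries_0, B_series_coef in Ev; simpl in Ev; lra.
  + replace (a 0%nat) with (PSeries (B_series a) v) by lra.
    apply PSeries_correct, CV_radius_inside; rewrite Rabs_pos_eq by lra.
    apply Rbar_le_lt_trans with y; [apply Hv|auto].
Qed.

Hypothesis radius_pos : Rbar_lt 0 (CV_radius a).
Hypothesis a_nonlinear : exists n, 0 < a (S (S n)).

(** For a finite radius [r], either [r] is itself a root, or some partial sum of [B] exceeds [A(0)]
    at [r], whether or not [B] converges there. That partial sum is a polynomial, so it still
    exceeds [A(0)] slightly to the left of [r], inside the disk of convergence. *)
Lemma B_root_exists :
  Rbar_le (a 0%nat) (B_at_radius a) ->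
  exists v, 0 < v /\ is_pseries (B_series a) v (a 0%nat).
Proof.
pose proof B_root_of_partial_sum_gt as Hroot; pose proof radius_pos as Hpos.
unfold B_at_radius; destruct (CV_radius a) as [r| |]; [| |contradiction].
- simpl in Hpos; intros Hle.
  assert (Hcase : is_pseries (B_series a) r (a 0%nat) \/
            exists N, a 0%nat < sum_n (fun n => B_series a n * r ^ n) N).
  { destruct (nonneg_series_cases _ (B_pterm_nonneg r ltac:(lra)))
      as [[l [Hl El]]|[_ [_ Hinf]]]; [|right; apply Hinf].
    rewrite El in Hle; destruct (Rle_lt_or_eq_dec _ _ Hle) as [Hlt|E].
    - right; apply Classical_Pred_Type.not_all_not_ex; intros Hno.
      apply (Rlt_not_le _ _ Hlt); refine (is_series_le_bound _ _ _ _ Hl).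
      intros N; apply Rnot_lt_le, Hno.
    - left; apply is_pseries_R; now rewrite E. }
  destruct Hcase as [Hr|[N HN]]; [exists r; auto|].
  destruct (continuous_partial_sum (B_series a) N r _
    (open_gt (a 0%nat) _ HN)) as [eps Heps].
  set (y := r - Rmin (eps / 2) (r / 2)).
  assert (Hmin : 0 < Rmin (eps / 2) (r / 2) <= r / 2 /\ Rmin (eps / 2) (r / 2) < eps).
  { pose proof (cond_pos eps).
    pose proof (Rmin_l (eps / 2) (r / 2)); pose proof (Rmin_r (eps / 2) (r / 2)).
    assert (0 < Rmin (eps / 2) (r / 2)) by (apply Rmin_pos; lra); lra. }
  apply (Hroot y N); [unfold y; lra|simpl; unfold y; lra|].
  apply Heps; change (Rabs (y - r) < eps).
  unfold y; apply Rabs_def1; lra.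
(* Infinite radius: at [1 + a 0 / c] one term of [B] suffices, being at least
   [c * (1 + a 0 / c) = c + a 0]. *)
- intros _; destruct a_nonlinear as [n Hn]; set (c := a (S (S n))) in *.
  assert (Ha0 : 0 <= a 0%nat / c) by (apply Rdiv_le_0_compat; auto).
  apply (Hroot (1 + a 0%nat / c) (S (S n))); [lra|exact I|].
  apply Rlt_le_trans with (B_series a (S (S n)) * (1 + a 0%nat / c) ^ S (S n)).
  + apply Rlt_le_trans with (c * (1 + a 0%nat / c)).
    { replace (c * (1 + a 0%nat / c)) with (c + a 0%nat) by (field; lra); lra. }
    apply Rmult_le_compat; try lra.
    * rewrite B_series_coef; fold c; rewrite <- (Rmult_1_l c) at 1.
      apply Rmult_le_compat_r; [lra|apply (le_INR 1); lia].
    * rewrite <- (pow_1 (1 + a 0%nat / c)) at 1; apply Rle_pow; [lra|lia].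
  + rewrite sum_Sn; change plus with Rplus.
    pose proof (sum_n_nonneg _ (S n) (B_pterm_nonneg (1 + a 0%nat / c) ltac:(lra))).
    lra.
Qed.

Lemma characteristic_point_x_times (p : R * R) :
  characteristic_point (x_times a) p <->
  exists v, 0 < v /\ is_pseries (B_series a) v (a 0%nat) /\ p = (v / PSeries a v, v).
Proof.
split.
- destruct p as [x y]; intros [Hx [Hy Hsys]]; simpl in *.
  apply characteristic_system_x_times in Hsys; auto.
  destruct Hsys as [HB ->]; now exists y.
- intros [v [Hv [HB ->]]].
  assert (Hx : 0 < v / PSeries a v).
  { apply Rdiv_lt_0_compat; [auto|].
    apply (PSeries_pos a v); auto; [lra|].
    apply PSeries_correct, ex_pseries_R, ex_series_of_B; auto; [lra|].
    exists (a 0%nat); now apply is_pseries_R. }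
  split; [auto|split; [auto|]]; now apply characteristic_system_x_times.
Qed.

Lemma characteristic_point_exists :
  (exists p, characteristic_point (x_times a) p) <->
  Rbar_le (a 0%nat) (B_at_radius a).
Proof.
split.
- intros [p Hp]; apply characteristic_point_x_times in Hp.
  destruct Hp as [v [Hv [HB _]]]; now apply B_at_radius_ge with v.
- intros Hle; destruct (B_root_exists Hle) as [v [Hv HB]].
  exists (v / PSeries a v, v); apply characteristic_point_x_times; now exists v.
Qed.

(** * Interior and boundary of the positive domain *)

Lemma characteristic_point_in_pos_domain (p : R * R) :
  characteristic_point (x_times a) p -> pos_domain (x_times a) p.
Proof.
intros [Hx [Hy [HG _]]]; split; [auto|split; [auto|]]; now rewrite HG.
Qed.

Lemma interior_pos_domain (p : R * R) :
  0 < fst p -> 0 < snd p -> Rbar_lt (snd p) (CV_radius a) ->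
  interior_R2 (pos_domain (x_times a)) p.
Proof.
destruct p as [x y]; simpl; intros Hx Hy Hlt.
destruct (Rbar_dense _ _ Hlt) as [z [Hyz Hz]].
(* This radius keeps both coordinates positive and the second one below [z], where [A] still
   converges. *)
assert (Heps : 0 < Rmin x (Rmin y (z - y))) by (repeat apply Rmin_pos; lra).
exists (mkposreal _ Heps); intros [x' y'] [Hx' Hy']; simpl in Hx', Hy'.
change (Rabs (x' - x) < Rmin x (Rmin y (z - y))) in Hx'.
change (Rabs (y' - y) < Rmin x (Rmin y (z - y))) in Hy'.
pose proof (Rmin_l x (Rmin y (z - y))); pose proof (Rmin_r x (Rmin y (z - y))).
pose proof (Rmin_l y (z - y)); pose proof (Rmin_r y (z - y)).
apply Rabs_def2 in Hx', Hy'.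
unfold pos_domain; simpl; split; [lra|split; [lra|]].
apply PSeries2_x_times_lt_infty; auto; try lra.
apply lt_CV_radius_ex_series; [lra|].
apply Rbar_lt_trans with z; [simpl; lra|auto].
Qed.

Lemma not_interior_pos_domain (p : R * R) :
  CV_radius a = snd p -> ~ interior_R2 (pos_domain (x_times a)) p.
Proof.
destruct p as [x y]; simpl; intros Hy [eps Heps].
pose proof (cond_pos eps).
(* Raising the second coordinate by [eps / 2] stays in the ball but passes the radius of
   convergence. *)
destruct (Heps (x, y + eps / 2)) as [Hx1 [Hy1 Hlt]].
{ split; [apply ball_center|].
  change (Rabs (y + eps / 2 - y) < eps); apply Rabs_def1; lra. }
simpl in Hx1, Hy1, Hlt.
apply PSeries2_x_times_lt_infty in Hlt; auto; [|lra].
apply ex_series_le_CV_radius in Hlt; [|lra].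
rewrite Hy in Hlt; simpl in Hlt; lra.
Qed.

End CharacteristicEquation.

Theorem corollary17 (a : nat -> R) :
  (well_conditioned (x_times a) <->
     (forall n, 0 <= a n) /\ Rbar_lt (Finite 0) (CV_radius a) /\
     a 0%nat <> 0 /\ (exists n, PS_derive (PS_derive a) n <> 0)) /\
  (well_conditioned (x_times a) ->
     (forall x y : R, 0 < x -> 0 < y ->
        (characteristic_system (x_times a) x y <->
         is_pseries (B_series a) y (a 0%nat) /\ x = y / PSeries a y)) /\
     (~ (exists p, characteristic_point (x_times a) p) <->
        Rbar_lt (B_at_radius a) (Finite (a 0%nat))) /\
     (forall t : nat -> R, standard_solution (x_times a) t ->
        (Rbar_le (Finite (a 0%nat)) (B_at_radius a) ->
           forall p, characteristic_point (x_times a) p <-> p = extreme_point t) /\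
        (B_at_radius a = Finite (a 0%nat) ->
           boundary_R2 (pos_domain (x_times a)) (extreme_point t)) /\
        (Rbar_lt (Finite (a 0%nat)) (B_at_radius a) ->
           interior_R2 (pos_domain (x_times a)) (extreme_point t)))).
Proof.
split; [apply well_conditioned_x_times|].
intros Hwc; apply well_conditioned_x_times in Hwc.
destruct Hwc as [Ha [Hr [Ha0 [n Hn]]]].
assert (Hnl : exists n, 0 < a (S (S n))).
{ exists n; destruct (Ha (S (S n))) as [|E]; [auto|].
  exfalso; apply Hn; unfold PS_derive; rewrite <- E; ring. }
split; [intros x y Hx Hy; now apply characteristic_system_x_times|].
split.
{ rewrite characteristic_point_exists by auto; split.
  - apply Rbar_not_le_lt.
  - apply Rbar_lt_not_le. }
intros t Ht.
assert (Hcp : forall p, characteristic_point (x_times a) p -> p = extreme_point t).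
{ intros p Hp; apply characteristic_point_x_times in Hp; auto.
  destruct Hp as [v [Hv [HB ->]]]; symmetry; now apply extreme_point_eq. }
(* Some characteristic point exists, and by [Hcp] it can only be the extreme point. *)
assert (Hext : Rbar_le (a 0%nat) (B_at_radius a) ->
          characteristic_point (x_times a) (extreme_point t)).
{ intros Hle; apply characteristic_point_exists in Hle; auto.
  destruct Hle as [p Hp]; now rewrite <- (Hcp p Hp). }
split; [|split].
- intros Hle p; split; [apply Hcp|intros ->; auto].
- intros HB.
  assert (Hp : characteristic_point (x_times a) (extreme_point t)).
  { apply Hext; rewrite HB; apply Rbar_le_refl. }
  split.
  + apply not_interior_pos_domain; [auto|].
    (* [B(r) = A(0)] says that the radius [r] is the root, so the extreme point has second
       coordinate [r]. *)
    unfold B_at_radius in HB; destruct (CV_radius a) as [r| |]; try discriminate.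
    simpl in Hr; apply Lim_seq_nonneg_series in HB;
      [|apply pterm_nonneg; [now apply B_series_nonneg|lra]].
    rewrite (extreme_point_eq a t Ha Ht Ha0 Hnl r Hr); [auto|].
    now apply is_pseries_R.
  (* The extreme point lies in the domain, so it is not interior to the complement. *)
  + intros Hloc; apply locally_singleton in Hloc.
    now apply Hloc, characteristic_point_in_pos_domain.
- intros HB; pose proof (Hext (Rbar_lt_le _ _ HB)) as Hp.
  destruct (proj1 (characteristic_point_x_times a Ha Ha0 _) Hp) as [v [Hv [Hroot E]]].
  destruct Hp as [Hx [Hy _]].
  apply interior_pos_domain; auto.
  rewrite E; now apply B_root_lt_radius.
Qed.
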